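(* Let $Q\in\mathbb{R}^{n\times n}$ be symmetric positive definite, $q\in\mathbb{R}^n$, $A\in\mathbb{R}^{m\times n}$ of full rank, $c\in\mathbb{R}^m$, and consider the quadratic program $$\text{minimize } \tfrac12x^\top Qx+q^\top x\quad\text{subject to } Ax\le c$$ and the corresponding relaxed ADMM iterations with step-size $\rho$ and relaxation parameter $\alpha$ $$x^{k+1}=-(Q+\rho A^\top A)^{-1}[q+\rho A^\top(z^k+u^k-c)],\qquad z^{k+1}=\max\{0,-\alpha(Ax^{k+1}-c)+(1-\alpha)z^k-u^k\},$$ $$u^{k+1}=u^k+\alpha(Ax^{k+1}+z^{k+1}-c)+(1-\alpha)(z^{k+1}-z^k).$$ If $\rho>0$ and $\alpha\in(0,2]$, then the equivalent fixed point iteration $$F^{k+1}v^{k+1}-F^kv^k=\tfrac{\alpha}{2}(I-2M)(v^k-v^{k-1})+\left(1-\tfrac{\alpha}{2}\right)(F^kv^k-F^{k-1}v^{k-1})$$ converges linearly in terms of the residual $F^{k+1}v^{k+1}-F^kv^k$. Moreover, the primal residual $r^k$ and the dual residual $s^k$ of the relaxed ADMM iterations converge R-linearly to zero.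
   Context: The maximum is componentwise and $\|\cdot\|$ is the Euclidean norm. $M=A(Q/\rho+A^\top A)^{-1}A^\top$. For $k\ge1$ the iterates satisfy $z^k,u^k\ge0$ and $z^k_iu^k_i=0$ for all $i$. For such $k$ let $v^k=z^k+u^k$, let $D^k$ be the diagonal $m\times m$ matrix with $D^k_{ii}=0$ if $u^k_i=0$ and $D^k_{ii}=1$ if $u_i^k\ne0$, and let $F^k=2D^k-I$; thus $D^kv^k=u^k$, $(I-D^k)v^k=z^k$, and $F^kv^k=u^k-z^k$. The primal and dual residuals are $r^{k+1}=Ax^{k+1}+z^{k+1}-c$ and $s^{k+1}=\rho A^\top(z^{k+1}-z^k)$. Linear convergence in terms of the residual $F^{k+1}v^{k+1}-F^kv^k$ means that there is $\zeta\in(0,1)$ with $\|F^{k+1}v^{k+1}-F^kv^k\|\le\zeta\|F^kv^k-F^{k-1}v^{k-1}\|$ for all indices $k$ for which the terms are defined. A sequence $y^k$ converges R-linearly to $0$ if there is a nonnegative scalar sequence $\nu_k$ with $\|y^k\|\le\nu_k$ for all $k$ and $\nu_k$ converging Q-linearly to $0$ (that is, $\nu_{k+1}\le\theta\nu_k$ for some $\theta\in(0,1)$).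
   Formalization: ''Full rank'' is taken as full row rank (rank A = m); for m > n with rank n the claim fails, e.g. A = (1,-1)^T, c = (-1,-1), where the two entries of r^k sum to at least 2, and feasible tall examples have a constant residual. *)

(* Defs.v *)
From mathcomp Require Import all_boot all_order all_algebra.
From mathcomp Require Import reals.

Set Implicit Arguments.
Unset Strict Implicit.
Unset Printing Implicit Defensive.

Import Order.TTheory GRing.Theory Num.Theory.
Local Open Scope ring_scope.

(* MathComp-Analysis puts the sup norm on matrices, hence a separate Euclidean
   norm. *)
Definition enorm (R : realType) (p : nat) (y : 'cV[R]_p) : R :=
  Num.sqrt (\sum_(i < p) y i 0 ^+ 2).

Definition sym_posdef (R : realType) (n : nat) (Q : 'M[R]_n) : Prop :=
  Q^T = Q /\ forall x : 'cV[R]_n, x != 0 -> 0 < (x^T *m Q *m x) 0 0.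

Definition pos_part (R : realType) (p : nat) (y : 'cV[R]_p) : 'cV[R]_p :=
  map_mx (Num.max 0) y.

(* The starting point z 0, u 0 is unconstrained, and x 0 is never used.
   For m > n and A of rank n the constraints A x <= c may be infeasible, and
   then A x^k + z^k - c cannot tend to 0: the full rank assumption on A in the
   convergence theorem is therefore full row rank, row_free A. *)
Definition relaxed_admm (R : realType) (m n : nat) (Q : 'M[R]_n) (q : 'cV[R]_n)
    (A : 'M[R]_(m, n)) (c : 'cV[R]_m) (rho alpha : R)
    (x : nat -> 'cV[R]_n) (z u : nat -> 'cV[R]_m) : Prop :=
  forall k : nat,
  [/\ x k.+1 = - (invmx (Q + rho *: (A^T *m A))
                    *m (q + rho *: (A^T *m (z k + u k - c)))),
      z k.+1 = pos_part (- (alpha *: (A *m x k.+1 - c))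
                         + (1 - alpha) *: z k - u k)
    & u k.+1 = u k + alpha *: (A *m x k.+1 + z k.+1 - c)
               + (1 - alpha) *: (z k.+1 - z k)].

Definition Mmx (R : realType) (m n : nat) (Q : 'M[R]_n) (A : 'M[R]_(m, n))
    (rho : R) : 'M[R]_m :=
  A *m invmx (rho^-1 *: Q + A^T *m A) *m A^T.

Definition Dmx (R : realType) (m : nat) (u : 'cV[R]_m) : 'M[R]_m :=
  diag_mx (\row_i (u i 0 != 0)%:R).

Definition Fmx (R : realType) (m : nat) (u : 'cV[R]_m) : 'M[R]_m :=
  2 *: Dmx u - 1%:M.

Definition vseq (R : realType) (m : nat) (z u : nat -> 'cV[R]_m) (k : nat)
  : 'cV[R]_m := z k + u k.

Definition Fvseq (R : realType) (m : nat) (z u : nat -> 'cV[R]_m) (k : nat)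
  : 'cV[R]_m := Fmx (u k) *m vseq z u k.

(* Meaningful for k >= 1: the complementarity behind D^k may fail at k = 0. *)
Definition fp_residual (R : realType) (m : nat) (z u : nat -> 'cV[R]_m)
    (k : nat) : 'cV[R]_m := Fvseq z u k.+1 - Fvseq z u k.

(* r^k and s^k; meaningful for k >= 1. *)
Definition primal_residual (R : realType) (m n : nat) (A : 'M[R]_(m, n))
    (c : 'cV[R]_m) (x : nat -> 'cV[R]_n) (z : nat -> 'cV[R]_m) (k : nat)
  : 'cV[R]_m := A *m x k + z k - c.

Definition dual_residual (R : realType) (m n : nat) (A : 'M[R]_(m, n))
    (rho : R) (z : nat -> 'cV[R]_m) (k : nat) : 'cV[R]_n :=
  rho *: (A^T *m (z k - z k.-1)).

(* Both notions below concern sequences indexed by k >= 1; the junk term at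
   k = 0 is ignored. *)
Definition converges_linearly (R : realType) (p : nat) (e : nat -> 'cV[R]_p)
  : Prop :=
  exists zeta : R, [/\ 0 < zeta, zeta < 1
    & forall k : nat, (0 < k)%N -> enorm (e k.+1) <= zeta * enorm (e k)].

Definition converges_Rlinearly_to0 (R : realType) (p : nat)
    (y : nat -> 'cV[R]_p) : Prop :=
  exists (nu : nat -> R) (theta : R), [/\ 0 < theta, theta < 1
    & forall k : nat, (0 < k)%N ->
        [/\ 0 <= nu k, enorm (y k) <= nu k & nu k.+1 <= theta * nu k]].

(* Main.v *)
(** Put [w = u - z = F v]. An ADMM step makes [z] and [u] the positive parts of
    [- w] and [w], so that [v = |w|] componentwise: the increments of [v], [z]
    and [u] are dominated by those of [w]. As [I - 2M] is a strict contraction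
    when [A] has full row rank, the fixed point recursion shrinks the increments
    of [w] by a factor [(1 - alpha / 2) + alpha / 2 * delta] with [delta < 1].
    Both residuals are linear in the increments of [z] and [u]. *)

Require Import Defs.
From mathcomp Require Import all_boot all_order all_algebra.
From mathcomp Require Import reals ring lra.

Set Implicit Arguments.
Unset Strict Implicit.
Unset Printing Implicit Defensive.

Import Order.TTheory GRing.Theory Num.Theory.
Local Open Scope ring_scope.

(** * Bilinear form of a matrix and Cauchy-Schwarz *)

Definition mxform (R : realType) (n : nat) (N : 'M[R]_n) (y t : 'cV[R]_n) : R :=
  (y^T *m N *m t) 0 0.

Lemma mxformDl (R : realType) (n : nat) (N : 'M[R]_n) (y y' t : 'cV[R]_n) :
  mxform N (y + y') t = mxform N y t + mxform N y' t.
Proof. by rewrite /mxform linearD /= !mulmxDl mxE. Qed.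

Lemma mxformZl (R : realType) (n : nat) (N : 'M[R]_n) a (y t : 'cV[R]_n) :
  mxform N (a *: y) t = a * mxform N y t.
Proof. by rewrite /mxform linearZ /= -!scalemxAl mxE. Qed.

Lemma mxformDr (R : realType) (n : nat) (N : 'M[R]_n) (y t t' : 'cV[R]_n) :
  mxform N y (t + t') = mxform N y t + mxform N y t'.
Proof. by rewrite /mxform mulmxDr mxE. Qed.

Lemma mxformZr (R : realType) (n : nat) (N : 'M[R]_n) a (y t : 'cV[R]_n) :
  mxform N y (a *: t) = a * mxform N y t.
Proof. by rewrite /mxform -scalemxAr mxE. Qed.

Lemma mxformC (R : realType) (n : nat) (N : 'M[R]_n) (y t : 'cV[R]_n) :
  N^T = N -> mxform N y t = mxform N t y.
Proof.
move=> NT; rewrite /mxform -[in RHS]NT.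
transitivity ((t^T *m N^T *m y)^T 0 0); last by rewrite mxE.
by rewrite !trmx_mul !trmxK mulmxA.
Qed.

Lemma mxform0 (R : realType) (n : nat) (N : 'M[R]_n) (y : 'cV[R]_n) :
  mxform N y 0 = 0.
Proof. by rewrite /mxform mulmx0 mxE. Qed.

Lemma mxform_ge0 (R : realType) (n : nat) (N : 'M[R]_n) (y : 'cV[R]_n) :
  sym_posdef N -> 0 <= mxform N y y.
Proof.
move=> [_ Npos]; have [->|/Npos/ltW //] := eqVneq y 0.
by rewrite mxform0.
Qed.

Lemma mxform_CauchySchwarz (R : realType) (n : nat) (N : 'M[R]_n)
    (y t : 'cV[R]_n) :
  sym_posdef N -> mxform N y t ^+ 2 <= mxform N y y * mxform N t t.
Proof.
move=> Npd; have [->|t0] := eqVneq t 0.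
  by rewrite !mxform0 expr0n mulr0.
have tpos : 0 < mxform N t t by apply: Npd.2.
(* This vector is [mxform N t t] times the [N]-orthogonal complement of [y] along [t]; its form
   equals [a * (d * a - b ^+ 2)] with [a > 0]. *)
have := mxform_ge0 (mxform N t t *: y + (- mxform N y t) *: t) Npd.
rewrite !(mxformDl, mxformDr, mxformZl, mxformZr) (mxformC t y Npd.1).
set a := mxform N t t in tpos *; set b := mxform N y t; set d := mxform N y y.
rewrite (_ : _ + _ = a * (d * a - b ^+ 2)); last by ring.
by rewrite pmulr_rge0 // subr_ge0.
Qed.

(** * The Euclidean norm as the form of the identity *)

Lemma mxform1E (R : realType) (p : nat) (y t : 'cV[R]_p) :
  mxform 1%:M y t = \sum_i y i 0 * t i 0.
Proof. by rewrite /mxform mulmx1 mxE; apply: eq_bigr => i _; rewrite mxE. Qed.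

Lemma mxform1_sqr (R : realType) (p : nat) (y : 'cV[R]_p) :
  mxform 1%:M y y = enorm y ^+ 2.
Proof.
rewrite sqr_sqrtr ?mxform1E; first by apply: eq_bigr => i _; rewrite expr2.
by apply: sumr_ge0 => i _; rewrite sqr_ge0.
Qed.

Lemma sym_posdef1 (R : realType) (p : nat) : sym_posdef (1%:M : 'M[R]_p).
Proof.
split=> [|y]; first exact: trmx1.
apply: contraNT; rewrite -/(mxform _ _ _) mxform1E -leNgt => le0.
have ge0 i : true -> 0 <= y i 0 * y i 0 by rewrite -expr2 sqr_ge0.
have /eqP : \sum_i y i 0 * y i 0 = 0.
  by apply/eqP; rewrite eq_le le0 sumr_ge0.
rewrite psumr_eq0 // => /allP y0.
apply/eqP/colP => i; rewrite mxE.
by have := y0 i (mem_index_enum i); rewrite mulf_eq0 orbb => /eqP.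
Qed.

Lemma enorm_ge0 (R : realType) (p : nat) (y : 'cV[R]_p) : 0 <= enorm y.
Proof. exact: sqrtr_ge0. Qed.

Lemma enorm_CauchySchwarz (R : realType) (p : nat) (y t : 'cV[R]_p) :
  mxform 1%:M y t <= enorm y * enorm t.
Proof.
have cs : `|mxform 1%:M y t| <= enorm y * enorm t.
  have := mxform_CauchySchwarz y t (sym_posdef1 R p).
  rewrite !mxform1_sqr -exprMn -real_normK ?num_real //.
  by rewrite ler_sqr ?nnegrE ?normr_ge0 ?mulr_ge0 ?enorm_ge0.
exact: le_trans (ler_norm _) cs.
Qed.

Lemma enormD (R : realType) (p : nat) (y t : 'cV[R]_p) :
  enorm (y + t) <= enorm y + enorm t.
Proof.
rewrite -ler_sqr ?nnegrE ?addr_ge0 ?enorm_ge0 // -!mxform1_sqr.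
rewrite !(mxformDl, mxformDr) (mxformC t y (trmx1 _ _)) !mxform1_sqr.
by have := enorm_CauchySchwarz y t; lra.
Qed.

Lemma enormZ (R : realType) (p : nat) a (y : 'cV[R]_p) :
  enorm (a *: y) = `|a| * enorm y.
Proof.
rewrite /enorm -sqrtr_sqr -sqrtrM ?sqr_ge0 // mulr_sumr.
by congr Num.sqrt; apply: eq_bigr => i _; rewrite mxE exprMn.
Qed.

Lemma ler_enorm (R : realType) (p : nat) (y t : 'cV[R]_p) :
  (forall i, `|y i 0| <= `|t i 0|) -> enorm y <= enorm t.
Proof.
move=> le; rewrite ler_wsqrtr // ler_sum // => i _.
by rewrite -ler_sqrt ?sqr_ge0 // !sqrtr_sqr.
Qed.

(** The constant is the Frobenius norm of [K]: Cauchy-Schwarz is applied to each row. *)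
Lemma enorm_mulmx_bound (R : realType) (p r : nat) (K : 'M[R]_(p, r)) :
  exists2 C : R, 0 <= C & forall y : 'cV[R]_r, enorm (K *m y) <= C * enorm y.
Proof.
pose C2 := \sum_i enorm (row i K)^T ^+ 2.
have C2ge0 : 0 <= C2 by apply: sumr_ge0 => i _; rewrite sqr_ge0.
exists (Num.sqrt C2) => [|y]; first exact: sqrtr_ge0.
rewrite -ler_sqr ?nnegrE ?mulr_ge0 ?enorm_ge0 ?sqrtr_ge0 //.
rewrite exprMn (sqr_sqrtr C2ge0) -(mxform1_sqr (K *m y)) mxform1E mulr_suml ler_sum // => i _.
have -> : (K *m y) i 0 = mxform 1%:M (row i K)^T y.
  by rewrite mxform1E mxE; apply: eq_bigr => j _; rewrite !mxE.
rewrite -expr2 -!mxform1_sqr.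
exact: mxform_CauchySchwarz (sym_posdef1 R r).
Qed.

(** * Symmetric positive definite matrices *)

Lemma sym_posdef_unitmx (R : realType) (p : nat) (N : 'M[R]_p) :
  sym_posdef N -> N \in unitmx.
Proof.
move=> [_ Npos]; rewrite -row_free_unit; apply: inj_row_free => y yN0.
apply/eqP; rewrite -trmx_eq0; apply: contraT => /Npos.
by rewrite trmxK yN0 mul0mx mxE ltxx.
Qed.

(** Neither eigenvalues nor compactness enter: [|y|^4 <= (y^T N y) (y^T N^-1 y)], and a bound [C]
    for [N^-1] gives [y^T N^-1 y <= C |y|^2]. Taking [C + 1] keeps the constant invertible. *)
Lemma sym_posdef_coercive (R : realType) (p : nat) (N : 'M[R]_p) :
  sym_posdef N ->
  exists2 kappa : R, 0 < kappa
    & forall y, kappa * enorm y ^+ 2 <= mxform N y y.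
Proof.
move=> Npd; have Nu := sym_posdef_unitmx Npd.
have [C C0 bndC] := enorm_mulmx_bound (invmx N).
have C1 : 0 < C + 1 by rewrite ltr_wpDl.
exists (C + 1)^-1 => [|y]; first by rewrite invr_gt0.
rewrite ler_pdivrMl //.
have [->|y0] := eqVneq y 0.
  by rewrite -mxform1_sqr !mxform0 mulr0.
have e0 : 0 < enorm y ^+ 2 by rewrite -mxform1_sqr; apply: (sym_posdef1 R p).2.
(* Cauchy-Schwarz for [N] between [y] and [N^-1 y] *)
have := mxform_CauchySchwarz y (invmx N *m y) Npd.
have form_inv t : mxform N t (invmx N *m y) = mxform 1%:M t y.
  by rewrite /mxform mulmx1 mulmxA mulmxK.
rewrite !form_inv (mxformC _ y (trmx1 _ _)) mxform1_sqr => cs.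
have inv_le : mxform 1%:M y (invmx N *m y) <= (C + 1) * enorm y ^+ 2.
  apply: le_trans (enorm_CauchySchwarz _ _) _.
  have := ler_wpM2l (enorm_ge0 y) (bndC y).
  rewrite mulrDl mul1r expr2 mulrCA; have := sqr_ge0 (enorm y); rewrite expr2; lra.
rewrite -(ler_pM2r e0) -expr2 (le_trans cs) // mulrAC mulrC.
by rewrite ler_wpM2r ?mxform_ge0.
Qed.

Lemma sym_posdef_congr (R : realType) (n p : nat) (S : 'M[R]_n)
    (B : 'M[R]_(n, p)) :
  sym_posdef S -> (forall y : 'cV[R]_p, B *m y = 0 -> y = 0) ->
  sym_posdef (B^T *m S *m B).
Proof.
move=> [ST Spos] Binj; split=> [|y y0].
  by rewrite !trmx_mul trmxK ST mulmxA.
have By0 : B *m y != 0 by apply: contraNneq y0 => /Binj->.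
by have := Spos _ By0; rewrite trmx_mul !mulmxA.
Qed.

Lemma sym_posdefZ (R : realType) (n : nat) a (S : 'M[R]_n) :
  0 < a -> sym_posdef S -> sym_posdef (a *: S).
Proof.
move=> a0 [ST Spos]; split=> [|y y0]; first by rewrite linearZ /= ST.
by rewrite -scalemxAr -scalemxAl mxE mulr_gt0 ?Spos.
Qed.

Lemma sym_posdefD_gram (R : realType) (m n : nat) (S : 'M[R]_n)
    (A : 'M[R]_(m, n)) :
  sym_posdef S -> sym_posdef (S + A^T *m A).
Proof.
move=> [ST Spos]; split=> [|y y0]; first by rewrite linearD /= ST trmx_mul trmxK.
rewrite mulmxDr mulmxDl mxE ltr_wpDr ?Spos //.
rewrite -[y^T *m _ *m y]/(y^T *m (A^T *m A) *m y).
have -> : (y^T *m (A^T *m A) *m y) 0 0 = mxform 1%:M (A *m y) (A *m y).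
  by rewrite /mxform mulmx1 trmx_mul !mulmxA.
by rewrite mxform1_sqr sqr_ge0.
Qed.

(** * The matrix [M] and its reflection [I - 2M] *)

Lemma trmx_Mmx (R : realType) (m n : nat) (Q : 'M[R]_n) (A : 'M[R]_(m, n)) rho :
  Q^T = Q -> (Mmx Q A rho)^T = Mmx Q A rho.
Proof.
move=> QT; rewrite /Mmx !trmx_mul trmxK trmx_inv linearD /= linearZ /= QT.
by rewrite trmx_mul trmxK mulmxA.
Qed.

(** Substituting [A^T A = P - S] in the middle of [M^2 = A P^-1 (A^T A) P^-1 A^T] leaves
    [M - B^T S B], where [B = P^-1 A^T] is injective because [A] has full row rank. *)
Lemma Mmx_subr_sqr_posdef (R : realType) (m n : nat) (Q : 'M[R]_n)
    (A : 'M[R]_(m, n)) rho :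
  sym_posdef Q -> row_free A -> 0 < rho ->
  sym_posdef (Mmx Q A rho - Mmx Q A rho *m Mmx Q A rho).
Proof.
move=> Qpd Afree rho0.
have Spd : sym_posdef (rho^-1 *: Q) by apply: sym_posdefZ; rewrite ?invr_gt0.
have Ppd := sym_posdefD_gram A Spd.
rewrite /Mmx; set S := rho^-1 *: Q in Spd Ppd *.
set P := S + A^T *m A in Ppd *.
have Pu := sym_posdef_unitmx Ppd.
pose B := invmx P *m A^T.
have BT : B^T = A *m invmx P by rewrite trmx_mul trmxK trmx_inv Ppd.1.
have -> : A *m invmx P *m A^T - A *m invmx P *m A^T *m (A *m invmx P *m A^T)
          = B^T *m S *m B.
  have -> : S = P - A^T *m A by rewrite addrK.
  rewrite mulmxBr mulmxBl BT /B !mulmxA; congr (_ - _).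
  by rewrite mulmxKV.
apply: sym_posdef_congr => // y By0.
have ATy : A^T *m y = 0 by rewrite -[LHS](mulKVmx Pu) (mulmxA (invmx P)) By0 mulmx0.
apply/eqP; rewrite -trmx_eq0; apply/eqP; apply: (row_free_inj Afree).
by rewrite mul0mx -[A]trmxK -trmx_mul ATy trmx0.
Qed.

(* [|y|^2 - |(I - 2M)y|^2 = 4 y^T (M - M^2) y], and with [S = Q / rho],
   [B = (S + A^T A)^-1 A^T], [M - M^2 = B^T S B] is positive definite. *)
Lemma reflection_Mmx_contraction (R : realType) (m n : nat) (Q : 'M[R]_n)
    (A : 'M[R]_(m, n)) rho :
  sym_posdef Q -> row_free A -> 0 < rho ->
  exists delta : R, [/\ 0 <= delta, delta < 1
    & forall y, enorm ((1%:M - 2 *: Mmx Q A rho) *m y) <= delta * enorm y].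
Proof.
move=> Qpd Afree rho0; have := Mmx_subr_sqr_posdef Qpd Afree rho0.
have MT := trmx_Mmx A rho Qpd.1; move: MT; set M := Mmx Q A rho => MT.
move=> /sym_posdef_coercive[kappa kappa0 coer].
(* The truncation at 0 avoids proving [4 * kappa <= 1], which can fail when [m = 0]. *)
have d0 : 0 <= Num.max 0 (1 - 4 * kappa) by rewrite le_max lexx.
exists (Num.sqrt (Num.max 0 (1 - 4 * kappa))); split=> [||y].
- exact: sqrtr_ge0.
- by rewrite -[ltRHS]sqrtr1 ltr_sqrt ?ltr01 // gt_max ltr01; lra.
have key : enorm ((1%:M - 2 *: M) *m y) ^+ 2 <= (1 - 4 * kappa) * enorm y ^+ 2.
  have My t : mxform 1%:M (M *m y) t = mxform M y t.
    by rewrite /mxform trmx_mul MT mulmx1.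
  have -> : (1%:M - 2 *: M) *m y = y + (- 2) *: (M *m y).
    by rewrite mulmxBl mul1mx -scalemxAl scaleNr.
  have MM : mxform M y (M *m y) = mxform (M *m M) y y.
    by rewrite /mxform !mulmxA.
  rewrite -mxform1_sqr !(mxformDl, mxformDr, mxformZl, mxformZr).
  rewrite (mxformC _ (M *m y) (trmx1 _ _)) !My mxform1_sqr MM.
  have := coer y.
  rewrite {1}/mxform mulmxBr mulmxBl mxE [X in _ + X]mxE -!/(mxform _ _ _).
  lra.
rewrite -ler_sqr ?nnegrE ?mulr_ge0 ?enorm_ge0 ?sqrtr_ge0 //.
rewrite exprMn (sqr_sqrtr d0) (le_trans key) // ler_wpM2r ?sqr_ge0 //.
by rewrite le_max lexx orbT.
Qed.

(** * The ADMM step in terms of [w = F v] *)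

Lemma dist_max0 (R : realType) (a b : R) :
  `|Num.max 0 a - Num.max 0 b| <= `|a - b|.
Proof.
rewrite ler_norml; apply/andP.
by case: (leP 0 a); case: (leP 0 b); case: (ger0P (a - b)) => *; split; lra.
Qed.

Lemma max0D_max0N (R : realType) (a : R) :
  Num.max 0 (- a) + Num.max 0 a = `|a|.
Proof. by case: (ger0P a) => ?; case: (leP 0 (- a)) => ?; lra. Qed.

(** Where [w > 0], [u] is nonzero, so [F] has entry 1 and [v = w]; elsewhere [u = 0], so [F] has
    entry -1 and [v = - w]. *)
Lemma Fvseq_pos_part (R : realType) (m : nat) (z u : nat -> 'cV[R]_m) k w :
  z k = pos_part (- w) -> u k = pos_part w -> Fvseq z u k = w.
Proof.
move=> zk uk; rewrite /Fvseq /Fmx mulmxBl mul1mx -scalemxAl /vseq.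
apply/colP => i; rewrite mul_diag_mx !mxE zk uk !mxE.
case: (leP 0 (- w i 0)) => ?; case: (leP 0 (w i 0)) => ?; rewrite ?eqxx; try lra.
  by rewrite /= mul0r; lra.
by rewrite gt_eqF /= ?mul1r; lra.
Qed.

(** The [z] update is the positive part of [- w], and the [u] update collapses to [w + z k.+1],
    which is then the positive part of [w]. Complementarity thus holds after one step from any
    start. *)
Lemma relaxed_admm_step (R : realType) (m n : nat) (Q : 'M[R]_n)
    (q : 'cV[R]_n) (A : 'M[R]_(m, n)) (c : 'cV[R]_m) (rho alpha : R)
    (x : nat -> 'cV[R]_n) (z u : nat -> 'cV[R]_m) (k : nat) :
  relaxed_admm Q q A c rho alpha x z u ->
  [/\ z k.+1 = pos_part (- Fvseq z u k.+1), u k.+1 = pos_part (Fvseq z u k.+1)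
    & Fvseq z u k.+1 = u k + alpha *: (A *m x k.+1 - c) - (1 - alpha) *: z k].
Proof.
move=> /(_ k)[_ zE uE].
set w := u k + _ - _.
have zw : z k.+1 = pos_part (- w).
  by rewrite zE /w; congr pos_part; apply/colP => i; rewrite !mxE; ring.
have uw : u k.+1 = pos_part w.
  have -> : u k.+1 = w + z k.+1.
    by rewrite uE /w; apply/colP => i; rewrite !mxE; ring.
  rewrite zw; apply/colP => i; rewrite !mxE.
  by case: leP => ?; case: leP => ?; lra.
by rewrite (Fvseq_pos_part zw uw).
Qed.

(** This is where [M] enters the recursion: [q] and [c] cancel in the difference, and factoring
    [rho] out of [Q + rho A^T A] cancels the [rho] in front of [A^T]. *)
Lemma relaxed_admm_residual_constraint (R : realType) (m n : nat) (Q : 'M[R]_n)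
    (q : 'cV[R]_n) (A : 'M[R]_(m, n)) (c : 'cV[R]_m) (rho alpha : R)
    (x : nat -> 'cV[R]_n) (z u : nat -> 'cV[R]_m) (k : nat) :
  sym_posdef Q -> 0 < rho -> relaxed_admm Q q A c rho alpha x z u ->
  A *m x k.+2 - A *m x k.+1 = - (Mmx Q A rho *m (vseq z u k.+1 - vseq z u k)).
Proof.
move=> Qpd rho_gt0 adm; have rho0 := lt0r_neq0 rho_gt0.
have [-> _ _] := adm k.+1; have [-> _ _] := adm k.
have -> : Q + rho *: (A^T *m A) = rho *: (rho^-1 *: Q + A^T *m A).
  by rewrite scalerDr scalerA mulfV // scale1r.
rewrite invmxZ; last first.
  by apply/sym_posdef_unitmx/sym_posdefZ/sym_posdefD_gram/sym_posdefZ;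
     rewrite ?invr_gt0.
rewrite !mulmxN -opprD -mulmxBr -mulmxBr.
have -> : q + rho *: (A^T *m (z k.+1 + u k.+1 - c))
          - (q + rho *: (A^T *m (z k + u k - c)))
          = rho *: (A^T *m (vseq z u k.+1 - vseq z u k)).
  rewrite opprD addrACA subrr add0r -scalerBr -mulmxBr; congr (_ *: (_ *m _)).
  by rewrite opprB addrA subrK.
by rewrite -scalemxAl -!scalemxAr scalerA mulVf // scale1r /Mmx !mulmxA.
Qed.

(** * Linear convergence of [w] and R-linear convergence of the residuals *)

Lemma converges_Rlinearly_of_linear (R : realType) (p r : nat)
    (e : nat -> 'cV[R]_p) (y : nat -> 'cV[R]_r) (C : R) :
  0 <= C -> converges_linearly e ->
  (forall k, (0 < k)%N -> enorm (y k.+1) <= C * enorm (e k)) ->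
  converges_Rlinearly_to0 y.
Proof.
move=> C0 [zeta [zeta0 zeta1 lin]] ye.
have eexp k : enorm (e k.+1) <= zeta ^+ k * enorm (e 1%N).
  elim: k => [|k IH]; first by rewrite mul1r.
  apply: le_trans (lin k.+1 isT) _.
  by rewrite exprS -mulrA ler_wpM2l // ltW.
(* The majorant is [zeta ^+ k * K]. The first summand covers [y 1], which [ye] does not bound; the
   second covers [k >= 2], the power 2 making up for the shifts in [ye] and [eexp]. *)
pose K := enorm (y 1%N) / zeta + C * enorm (e 1%N) / zeta ^+ 2.
have K1 : 0 <= enorm (y 1%N) / zeta by rewrite divr_ge0 ?enorm_ge0 // ltW.
have K2 : 0 <= C * enorm (e 1%N) / zeta ^+ 2.
  by rewrite divr_ge0 ?mulr_ge0 ?enorm_ge0 ?exprn_ge0 // ltW.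
exists (fun k => zeta ^+ k * K), zeta; split=> // k k0; split.
- by rewrite mulr_ge0 ?exprn_ge0 ?addr_ge0 // ltW.
- case: k k0 => [//|[|k]] _.
    apply: (@le_trans _ _ (zeta ^+ 1 * (enorm (y 1%N) / zeta))).
      by rewrite mulrC divfK // gt_eqF.
    by rewrite ler_wpM2l ?exprn_ge0 ?lerDl // ltW.
  apply: le_trans (ye k.+1 isT) _.
  apply: le_trans (ler_wpM2l C0 (eexp k)) _.
  apply: (@le_trans _ _ (zeta ^+ k.+2 * (C * enorm (e 1%N) / zeta ^+ 2))).
    rewrite -addn2 exprD -mulrA [zeta ^+ 2 * _]mulrC divfK 1?mulrCA //.
    by rewrite expf_neq0 // gt_eqF.
  by rewrite ler_wpM2l ?exprn_ge0 ?lerDr // ltW.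
- by rewrite exprS mulrA.
Qed.

Theorem theorem6 (R : realType) (m n : nat)
    (Q : 'M[R]_n) (q : 'cV[R]_n) (A : 'M[R]_(m, n)) (c : 'cV[R]_m)
    (rho alpha : R) (x : nat -> 'cV[R]_n) (z u : nat -> 'cV[R]_m)
    (hQ : sym_posdef Q) (hA : row_free A)
    (hrho : 0 < rho) (halpha : 0 < alpha <= 2)
    (hadmm : relaxed_admm Q q A c rho alpha x z u) :
  [/\ forall k : nat, (1 < k)%N ->
        Fvseq z u k.+1 - Fvseq z u k =
          (alpha / 2) *: ((1%:M - 2 *: Mmx Q A rho)
                            *m (vseq z u k - vseq z u k.-1))
          + (1 - alpha / 2) *: (Fvseq z u k - Fvseq z u k.-1),
      converges_linearly (fp_residual z u),
      converges_Rlinearly_to0 (primal_residual A c x z)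
    & converges_Rlinearly_to0 (dual_residual A rho z)].
Proof.
have /andP[alpha0 alpha2] := halpha.
have step k := relaxed_admm_step k hadmm.
have split_uz k : Fvseq z u k.+1 = u k.+1 - z k.+1.
  have [-> -> _] := step k; apply/colP => i; rewrite !mxE.
  by case: leP => ?; case: leP => ?; lra.
have fixed_point k : Fvseq z u k.+3 - Fvseq z u k.+2 =
          (alpha / 2) *: ((1%:M - 2 *: Mmx Q A rho)
                            *m (vseq z u k.+2 - vseq z u k.+1))
          + (1 - alpha / 2) *: (Fvseq z u k.+2 - Fvseq z u k.+1).
  (* Subtracting the two formulas for [w] leaves [du - (1 - alpha) dz - alpha M dv]. With
     [dv = du + dz] and [dw = du - dz], the first two terms are
     [alpha / 2 dv + (1 - alpha / 2) dw]. *)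
  have [_ _ ->] := step k.+2; have [_ _ Fk] := step k.+1.
  rewrite mulmxBl mul1mx -scalemxAl -[in RHS](opprK (_ *m _)).
  rewrite -(relaxed_admm_residual_constraint _ hQ hrho hadmm).
  rewrite {1}Fk !split_uz /vseq; apply/colP => i; rewrite !mxE; by field.
have dv_le k : enorm (vseq z u k.+2 - vseq z u k.+1)
               <= enorm (fp_residual z u k.+1).
  apply: ler_enorm => i; rewrite /vseq /fp_residual.
  have [-> -> _] := step k.+1; have [-> -> _] := step k; rewrite !mxE.
  by rewrite !max0D_max0N ler_dist_dist.
have dz_le k : enorm (z k.+2 - z k.+1) <= enorm (fp_residual z u k.+1).
  apply: ler_enorm => i; rewrite /fp_residual.
  have [-> _ _] := step k.+1; have [-> _ _] := step k; rewrite !mxE.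
  by rewrite (le_trans (dist_max0 _ _)) // -opprD normrN.
have du_le k : enorm (u k.+2 - u k.+1) <= enorm (fp_residual z u k.+1).
  apply: ler_enorm => i; rewrite /fp_residual.
  have [_ -> _] := step k.+1; have [_ -> _] := step k; rewrite !mxE.
  exact: dist_max0.
have lin : converges_linearly (fp_residual z u).
  have [delta [delta0 delta1 contr]] := reflection_Mmx_contraction hQ hA hrho.
  (* The maximum with 1/2 keeps the rate positive when [alpha = 2] and [delta = 0]. *)
  exists ((1 - alpha / 2) + alpha / 2 * Num.max (1 / 2) delta).
  set d := Num.max _ _.
  have d0 : 0 < d by rewrite lt_max; apply/orP; left; lra.
  have d1 : d < 1 by rewrite gt_max delta1 andbT; lra.
  split; [|by nra|case=> [//|k] _]; first by nra.
  rewrite {1}/fp_residual fixed_point addrC mulrDl.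
  apply: le_trans (enormD _ _) _; rewrite !enormZ !ger0_norm; [|lra..].
  rewrite lerD2l -mulrA ler_wpM2l //; first lra.
  apply: le_trans (contr _) _.
  by rewrite ler_pM ?enorm_ge0 // le_max lexx orbT.
split=> //; first by case=> [|[|k]] // _; apply: fixed_point.
  apply: (converges_Rlinearly_of_linear (C := alpha^-1 * (1 + `|1 - alpha|)) _ lin).
    by rewrite mulr_ge0 ?invr_ge0 ?addr_ge0 // ltW.
  case=> [//|k] _.
  (* The [u] update, solved for the primal residual. *)
  have -> : primal_residual A c x z k.+2 =
     alpha^-1 *: ((u k.+2 - u k.+1) + (alpha - 1) *: (z k.+2 - z k.+1)).
    have [_ _ ->] := hadmm k.+1; rewrite /primal_residual.
    by apply/colP => i; rewrite !mxE; field; rewrite gt_eqF.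
  rewrite enormZ gtr0_norm ?invr_gt0 // -mulrA ler_pM2l ?invr_gt0 //.
  apply: le_trans (enormD _ _) _; rewrite mulrDl mul1r lerD // enormZ distrC.
  by rewrite ler_wpM2l.
have [C C0 bndC] := enorm_mulmx_bound A^T.
apply: (converges_Rlinearly_of_linear (C := rho * C) _ lin).
  by rewrite mulr_ge0 // ltW.
case=> [//|k] _; rewrite /dual_residual /= enormZ gtr0_norm // -mulrA.
by rewrite ler_pM2l // (le_trans (bndC _)) // ler_wpM2l.
Qed.
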